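(* Let $s\le\ell$ be positive integers and consider the instance of Problem 1 (defined in the context) with these parameters. Let $\Omega_{s,\mathbf{i}}$ ($\mathbf{i}\in\mathcal{I}$) be the unique elements of $\mathcal{R}$ with $\deg_{\mathcal{H}}\Omega_{s,\mathbf{i}}\le\deg_{\mathcal{H}}\Lambda_s+|\mathbf{i}|(2g-1)$ and $\Lambda_s(\mathbf{f}-\mathbf{R})^{\mathbf{i}}=G^{|\mathbf{i}|}\Omega_{s,\mathbf{i}}$. Then $$\lambda_{\mathbf{i}}=\Omega_{s,\mathbf{i}}\ (\mathbf{i}\in\mathcal{I}),\qquad \psi_{\mathbf{j}}=\Lambda_s\mathbf{f}^{\mathbf{j}}\ (\mathbf{j}\in\mathcal{J})$$ is a solution of Problem 1 of degree $\tau=\deg_{\mathcal{H}}\Lambda_s$, where $s|\mathcal{E}|\le\tau\le s|\mathcal{E}|+g$.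
   Context: Let $q$ be a prime power. The Hermitian curve over $\mathbb{F}_{q^2}$ is the smooth projective plane curve with affine equation $Y^q+Y=X^{q+1}$; genus $g=\tfrac12q(q-1)$, affine rational points $P_1,\dots,P_n$ ($n=q^3$), point at infinity $P_\infty$. $\mathcal{R}=\bigcup_{m\ge0}\mathcal{L}(mP_\infty)=\mathbb{F}_{q^2}[X,Y]/(Y^q+Y-X^{q+1})$ with basis $\{X^iY^j:i\ge0,0\le j<q\}$; $\deg_{\mathcal{H}}f=-v_{P_\infty}(f)$, so $\deg_{\mathcal{H}}(X^iY^j)=iq+j(q+1)$; $f\ne0$ is monic if the coefficient of its basis monomial of largest $\deg_{\mathcal{H}}$ is $1$. Fix integers $h\ge1$ and $m_{\mathrm H}$ with $2(g-1)<m_{\mathrm H}<n$. Let $\mathbf{f}=(f_1,\dots,f_h)\in\mathcal{L}(m_{\mathrm H}P_\infty)^h$, $\mathbf{r}=\mathbf{c}+\mathbf{e}\in\mathbb{F}_{q^2}^{h\times n}$ where $\mathbf{c}$ has $i$-th row $(f_i(P_1),\dots,f_i(P_n))$, and $\mathcal{E}$ the set of indices of nonzero columns of $\mathbf{e}$. $\Lambda_s$ is the unique monic element of minimal $\deg_{\mathcal{H}}$ of $\{\Lambda\in\mathcal{R}:v_{P_i}(\Lambda)\ge s\ \forall i\in\mathcal{E}\}$. $\mathbf{R}=(R_1,\dots,R_h)$, $R_i\in\mathcal{R}$, $\deg_{\mathcal{H}}R_i<n+2g$, $R_i(P_j)=r_{i,j}$; $G=X^{q^2}-X$. Vector notation for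 $\mathbf{i},\mathbf{j}\in\mathbb{Z}_{\ge0}^h$: $|\mathbf{i}|=\sum_\mu i_\mu$; $\mathbf{i}\preceq\mathbf{j}$ componentwise; $\mathbf{a}^{\mathbf{i}}=\prod_\mu a_\mu^{i_\mu}$; $\binom{\mathbf{j}}{\mathbf{i}}=\prod_\mu\binom{j_\mu}{i_\mu}$. Problem 1: given $s\le\ell$, let $\mathcal{I}=\{\mathbf{i}\in\mathbb{Z}_{\ge0}^h:|\mathbf{i}|<s\}$, $\mathcal{J}=\{\mathbf{j}\in\mathbb{Z}_{\ge0}^h:1\le|\mathbf{j}|\le\ell\}$, and $A_{\mathbf{i},\mathbf{j}}=\binom{\mathbf{j}}{\mathbf{i}}\mathbf{R}^{\mathbf{j}-\mathbf{i}}G^{|\mathbf{i}|}\in\mathcal{R}$ (which is $0$ when $\mathbf{i}\not\preceq\mathbf{j}$). A solution is a family $\lambda_{\mathbf{i}},\psi_{\mathbf{j}}\in\mathcal{R}$ ($\mathbf{i}\in\mathcal{I},\mathbf{j}\in\mathcal{J}$) with $\lambda_{\mathbf{0}}$ monic such that: $\psi_{\mathbf{j}}=\sum_{\mathbf{i}\in\mathcal{I}}\lambda_{\mathbf{i}}A_{\mathbf{i},\mathbf{j}}$ for $|\mathbf{j}|<s$; $\psi_{\mathbf{j}}\equiv\sum_{\mathbf{i}\in\mathcal{I}}\lambda_{\mathbf{i}}A_{\mathbf{i},\mathbf{j}}\bmod G^s$ for $|\mathbf{j}|\ge s$; $\deg_{\mathcal{H}}\lambda_{\mathbf{0}}\ge\deg_{\mathcal{H}}\lambda_{\mathbf{i}}-|\mathbf{i}|(2g-1)$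 for all $\mathbf{i}\in\mathcal{I}$; $\deg_{\mathcal{H}}\lambda_{\mathbf{0}}\ge\deg_{\mathcal{H}}\psi_{\mathbf{j}}-|\mathbf{j}|m_{\mathrm H}$ for all $\mathbf{j}\in\mathcal{J}$. The degree of a solution is $\deg_{\mathcal{H}}\lambda_{\mathbf{0}}$. *)

(* Defs.v *)
From HB Require Import structures.
From mathcomp Require Import all_boot all_order all_algebra.
Set Implicit Arguments. Unset Strict Implicit. Unset Printing Implicit Defensive.
Import Order.TTheory GRing.Theory Num.Theory.
Local Open Scope ring_scope.

(* Elements of R = F[X,Y]/(Y^q+Y-X^(q+1)) are represented by bivariate
   polynomials: the outer variable ('X of {poly {poly F}}) is Y, the inner
   variable ('X of {poly F}) is X.  Equality in R is congruence modulo the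
   (Y-monic) curve polynomial. *)
Notation bpoly F := {poly {poly F}}.

Section Hermitian.
Variable F : fieldType.
Variable q : nat.

Definition curveH : bpoly F := 'X^q + 'X - (('X : {poly F}) ^+ q.+1)%:P.

Definition eqR (u v : bpoly F) : Prop := (u - v) %% curveH = 0.

Definition Gpoly : bpoly F := ('X ^+ (q ^ 2)%N - 'X)%:P.

Definition genus : nat := ((q * (q - 1)) %/ 2)%N.

Definition coefH (p : bpoly F) (i j : nat) : F := ((p %% curveH)`_j)`_i.

Definition rowH (p : bpoly F) (j : nat) : {poly F} := (p %% curveH)`_j.
Definition coefnz (p : bpoly F) (i j : nat) : bool := coefH p i j != 0.

(* deg_H = -v_{P_oo}; deg(X^i Y^j) = i q + j (q+1); convention deg_H 0 = 0 *)
Definition degH (p : bpoly F) : nat :=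
  (\max_(j < q) \max_(i < size (rowH p j))
     (if coefnz p i j then i * q + j * q.+1 else 0))%N.

Definition monicH (p : bpoly F) : Prop :=
  exists i j : nat, (j < q)%N /\ coefH p i j = 1 /\ (i * q + j * q.+1)%N = degH p.

Definition evH (P : F * F) (p : bpoly F) : F := (p.[(P.2)%:P]).[P.1].

Definition onH (P : F * F) : bool := P.2 ^+ q + P.2 == P.1 ^+ q.+1.

(* v_P(f) >= s : f lies in m_P^s, m_P the maximal ideal of the local ring
   O_P = R_(M_P), M_P = (X-a, Y-b); i.e. u f in M_P^s for some u with u(P) != 0 *)
Definition vgeH (P : F * F) (s : nat) (f : bpoly F) : Prop :=
  exists u : bpoly F, evH P u != 0 /\
  exists c : nat -> bpoly F,
    eqR (u * f) (\sum_(k < s.+1) c k * (('X - (P.1)%:P)%:P) ^+ k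
                                    * ('X - (P.2)%:P%:P) ^+ (s - k)).

Definition isLambda (n : nat) (P : 'I_n -> F * F) (E : {set 'I_n}) (s : nat)
    (Lam : bpoly F) : Prop :=
  monicH Lam /\ (forall k, k \in E -> vgeH (P k) s Lam) /\
  (forall L : bpoly F, ~ eqR L 0 -> (forall k, k \in E -> vgeH (P k) s L) ->
     (degH Lam <= degH L)%N).

End Hermitian.

Notation mi h := {ffun 'I_h -> nat}.
Definition mnorm h (i : mi h) : nat := (\sum_mu i mu)%N.
Definition mle h (i j : mi h) : bool := [forall mu, (i mu <= j mu)%N].
Definition msub h (j i : mi h) : mi h := [ffun mu => (j mu - i mu)%N].
Definition mbinom h (j i : mi h) : nat := (\prod_mu 'C(j mu, i mu))%N.
Definition mpow (T : comNzRingType) h (a : 'I_h -> T) (i : mi h) : T :=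
  \prod_mu a mu ^+ i mu.
Definition m0 h : mi h := [ffun _ => 0%N].
Definition ofI h s (k : {ffun 'I_h -> 'I_s}) : mi h := [ffun mu => nat_of_ord (k mu)].

Section Problem1.
Variable F : fieldType.
Variable q : nat.

Definition Acoef h (Rv : 'I_h -> bpoly F) (i j : mi h) : bpoly F :=
  if mle i j then (mbinom j i)%:R * mpow Rv (msub j i) * Gpoly F q ^+ mnorm i
  else 0.

Definition sumI h s (Rv : 'I_h -> bpoly F) (lam : mi h -> bpoly F) (j : mi h) :=
  \sum_(k : {ffun 'I_h -> 'I_s} | (mnorm (ofI k) < s)%N)
     lam (ofI k) * Acoef Rv (ofI k) j.

Definition isSolution h (s l mH : nat) (Rv : 'I_h -> bpoly F)
    (lam psi : mi h -> bpoly F) : Prop :=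
  monicH q (lam (m0 h)) /\
  (forall j : mi h, (1 <= mnorm j <= l)%N -> (mnorm j < s)%N ->
      eqR q (psi j) (sumI s Rv lam j)) /\
  (forall j : mi h, (1 <= mnorm j <= l)%N -> (s <= mnorm j)%N ->
      exists t : bpoly F, eqR q (psi j - sumI s Rv lam j) (Gpoly F q ^+ s * t)) /\
  (forall i : mi h, (mnorm i < s)%N ->
      (degH q (lam i) <= degH q (lam (m0 h)) + mnorm i * (2 * genus q - 1))%N) /\
  (forall j : mi h, (1 <= mnorm j <= l)%N ->
      (degH q (psi j) <= degH q (lam (m0 h)) + mnorm j * mH)%N).

End Problem1.

Definition errset {F : fieldType} {h n : nat} (e : 'M[F]_(h, n)) : {set 'I_n} :=
  [set k | col k e != 0].

(* Main.v *)
Require Import Defs.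
From HB Require Import structures.
From mathcomp Require Import all_boot all_order all_algebra.
From mathcomp Require Import finfield zify ring.
Import GRing.Theory.
Local Open Scope ring_scope.

(* Expanding [Y] in powers of [X - a] at a rational point [P = (a, b)] turns
   [v_P(g) >= s] into [s] linear conditions on [g].

   - The binomial theorem for [f = (f - R) + R] gives the key equations up to
     the terms [Lambda (f - R)^i] with [|i| >= s], which have to be divisible by
     [G^s].  They are, because [Omega_i (f - R)_mu] with [|i| = s - 1] vanishes
     at every rational point: [f - R] does so off the error set, and [Omega_i] on
     it, since [G] has only simple zeros.  A function vanishing at all points is
     divisible by [G], as each fibre of [X] has exactly [q] points.
   - Upper bound on [deg Lambda]: the functions of degree at most [s|E| + g] form
     a space of dimension larger than [s|E|], the semigroup generated by [q] and
     [q + 1] having at most [g] gaps.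
   - Lower bound: by the Chinese remainder theorem the [s|E|] conditions are
     independent modulo multiples of [Lambda], and modulo [Lambda] every function
     is a combination of at most [deg Lambda] basis monomials. *)

(** * Congruence modulo the curve equation *)

Section CoordinateRing.
Set Implicit Arguments. Unset Strict Implicit. Unset Printing Implicit Defensive.
Variables (F : fieldType) (q : nat).
Hypothesis q_gt1 : (1 < q)%N.

Local Notation bpoly := (bpoly F).
Local Notation curve := (curveH F q).
Local Notation "u ~ v" := (eqR q u v) (at level 70).
Implicit Types (u v p f g : bpoly) (m w : nat) (c : F).

Lemma curve_tail_size :
  (size ('X - (('X : {poly F}) ^+ q.+1)%:P : bpoly)%R < size ('X^q : bpoly)%R)%N.
Proof. by rewrite size_XsubC size_polyXn. Qed.

Lemma size_curveH : size curve = q.+1.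
Proof. by rewrite /curveH -addrA size_polyDl ?curve_tail_size ?size_polyXn. Qed.

Lemma lead_coef_curveH : lead_coef curve = 1.
Proof. by rewrite /curveH -addrA lead_coefDl ?curve_tail_size ?lead_coefXn. Qed.

(** Coefficients lie in the domain [{poly F}], not in a field; the division lemmas below need a
    divisor whose leading coefficient is a unit. *)
Let curve_unit : lead_coef curve \is a GRing.unit.
Proof. by rewrite lead_coef_curveH unitr1. Qed.

Lemma eqRP u v : u ~ v <-> exists t, u = v + t * curve.
Proof.
split=> [uv|[t ->]]; last by rewrite /eqR addrAC subrr add0r modp_mull.
exists ((u - v) %/ curve).
have := Pdiv.IdomainUnit.divp_eq curve_unit (u - v); rewrite uv addr0 => <-.
by rewrite addrC subrK.
Qed.

Lemma eqR_modp u v : u ~ v <-> u %% curve = v %% curve.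
Proof.
rewrite /eqR Pdiv.IdomainUnit.modpD // Pdiv.IdomainUnit.modpN //.
by split=> [/eqP|->]; rewrite ?subrr // subr_eq0 => /eqP.
Qed.

Lemma size_modH p : (size (p %% curve)%R <= q)%N.
Proof.
by rewrite -ltnS -size_curveH ltn_modp -size_poly_eq0 size_curveH.
Qed.

Lemma eqR_nf u : u ~ u %% curve.
Proof. by apply/eqR_modp; rewrite [RHS]modp_small // size_curveH ltnS size_modH. Qed.

Lemma eqRxx u : u ~ u. Proof. by apply/eqR_modp. Qed.

Lemma eqR_sym u v : u ~ v -> v ~ u.
Proof. by rewrite !eqR_modp. Qed.

Lemma eqR_trans v u f : u ~ v -> v ~ f -> u ~ f.
Proof. by rewrite !eqR_modp => ->. Qed.

Lemma eqRD u u' v v' : u ~ u' -> v ~ v' -> u + v ~ u' + v'.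
Proof. by rewrite !eqR_modp !Pdiv.IdomainUnit.modpD // => -> ->. Qed.

Lemma eqRB u u' v v' : u ~ u' -> v ~ v' -> u - v ~ u' - v'.
Proof.
by rewrite !eqR_modp !Pdiv.IdomainUnit.modpD // !Pdiv.IdomainUnit.modpN // => -> ->.
Qed.

Lemma eqRM u u' v v' : u ~ u' -> v ~ v' -> u * v ~ u' * v'.
Proof.
move=> /eqRP[a ->] /eqRP[b ->]; apply/eqRP.
by exists (a * v' + u' * b + a * b * curve); ring.
Qed.

Lemma eqR_sum I (r : seq I) (P : pred I) (U V : I -> bpoly) :
  (forall i, P i -> U i ~ V i) -> \sum_(i <- r | P i) U i ~ \sum_(i <- r | P i) V i.
Proof.
move=> UV; elim/big_rec2: _ => [|i v u Pi uv]; first exact: eqRxx.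
exact: eqRD (UV i Pi) uv.
Qed.

(** * Pole order at infinity *)

(* The leading form of the curve equation is [Y^q = X^(q+1)], solved by
   [X = t^q, Y = t^(q+1)]; after reduction the basis monomials go to distinct
   powers of [t], so [poleH p] has degree [degH p], and [poleH] is
   multiplicative up to lower order terms. *)
Definition weigh p : {poly F} := (map_poly (comp_poly 'X^q) p).['X^(q.+1)].

Definition poleH p : {poly F} := weigh (p %% curve).

(** As [i * q + j * q.+1 = (i + j) * q + j], for [j < q] division of [m] by [q] leaves remainder [j]
    and quotient [i + j]; hence the test, and the exponents in [monoH]. *)
Definition semigroupH m : bool := (m %% q <= m %/ q)%N.
Definition monoH m : bpoly := ('X^(m %/ q - m %% q))%:P * 'X^(m %% q).

Let q_gt0 : (0 < q)%N. Proof. exact: ltnW. Qed.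

Lemma weighD u v : weigh (u + v) = weigh u + weigh v.
Proof. by rewrite /weigh rmorphD hornerD. Qed.

Lemma weighM u v : weigh (u * v) = weigh u * weigh v.
Proof. by rewrite /weigh rmorphM hornerM. Qed.

Lemma weighC (a : {poly F}) : weigh a%:P = a \Po 'X^q.
Proof. by rewrite /weigh map_polyC hornerC. Qed.

Lemma weigh_mono i j : weigh (('X^i)%:P * 'X^j) = 'X^(i * q + j * q.+1).
Proof.
rewrite weighM weighC comp_Xn_poly -exprM /weigh map_polyXn.
by rewrite hornerXn -exprM exprD; congr (_ ^+ _ * _ ^+ _); rewrite mulnC.
Qed.

(** Any [j] is allowed: the remainder is at most [j] and the quotient at least [j], so the test
    describes the whole semigroup generated by [q] and [q.+1]. *)
Lemma semigroupHP m :
  reflect (exists i j, m = i * q + j * q.+1)%N (semigroupH m).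
Proof.
apply: (iffP idP) => [Sm|[i [j ->]]].
  exists (m %/ q - m %% q)%N, (m %% q)%N; rewrite mulnS addnCA -mulnDl subnK //.
  by rewrite addnC -divn_eq.
rewrite /semigroupH mulnS addnCA addnC -mulnDl modnMDl divnMDl // addnAC.
exact: leq_trans (leq_mod _ _) (leq_addl _ _).
Qed.

Lemma semigroupHE m : semigroupH m ->
  ((m %/ q - m %% q) * q + (m %% q) * q.+1)%N = m.
Proof.
move=> Sm; rewrite mulnS addnCA -mulnDl subnK //.
by rewrite addnC -divn_eq.
Qed.

Lemma semigroupHD m w : semigroupH m -> semigroupH w -> semigroupH (m + w).
Proof.
move=> /semigroupHP[i [j ->]] /semigroupHP[i' [j' ->]]; apply/semigroupHP.
by exists (i + i')%N, (j + j')%N; rewrite !mulnDl addnACA.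
Qed.

Lemma poleHD u v : poleH (u + v) = poleH u + poleH v.
Proof. by rewrite /poleH Pdiv.IdomainUnit.modpD // weighD. Qed.

Lemma poleHCM c u : poleH (c%:P%:P * u) = c *: poleH u.
Proof.
by rewrite /poleH mul_polyC Pdiv.IdomainUnit.modpZl // -mul_polyC weighM weighC
  comp_polyC mul_polyC.
Qed.

Lemma poleHB u v : poleH (u - v) = poleH u - poleH v.
Proof.
by rewrite poleHD -mulN1r -[- 1]/(- 1%:P%:P) -!polyCN poleHCM scaleN1r.
Qed.

Lemma poleH0 : poleH 0 = 0.
Proof. by rewrite -[0](subrr 0) poleHB subrr. Qed.

Lemma poleH_sum I (r : seq I) (P : pred I) (U : I -> bpoly) :
  poleH (\sum_(i <- r | P i) U i) = \sum_(i <- r | P i) poleH (U i).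
Proof. by apply: big_morph; [exact: poleHD | exact: poleH0]. Qed.

Lemma poleHE p :
  poleH p = \sum_(j < q) (rowH q p j \Po 'X^q) * 'X^(j * q.+1).
Proof.
rewrite /poleH /weigh (@horner_coef_wide _ q); last first.
  by rewrite (leq_trans (size_poly _ _)) ?size_modH.
by apply: eq_bigr => j _; rewrite coef_map /= -exprM [(q.+1 * _)%N]mulnC.
Qed.

(** The weight is congruent to [j] modulo [q], so for [j < q] it determines [j] and then [i]:
    distinct basis monomials never share a power. *)
Lemma poleH_coef p i j : (j < q)%N -> (poleH p)`_(i * q + j * q.+1) = coefH q p i j.
Proof.
move=> ltjq; rewrite poleHE coef_sum (bigD1 (Ordinal ltjq)) //= big1 => [|k nkj].
  rewrite addr0 coefMXn ltnNge leq_addl /= addnK coef_comp_poly_Xn // dvdn_mull //.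
  by rewrite mulnK.
rewrite coefMXn; case: ltnP => // le_k; rewrite coef_comp_poly_Xn //.
case: dvdnP => // -[d dE]; case/negP: nkj; apply/eqP/val_inj => /=.
have modE a b : ((a * q + b * q.+1) %% q = b %% q)%N.
  by rewrite mulnS addnCA -mulnDl addnC modnMDl.
have : ((d * q + k * q.+1) %% q = (i * q + j * q.+1) %% q)%N by rewrite -dE subnK.
by rewrite !modE !modn_small.
Qed.

Lemma poleH_supp p m : (poleH p)`_m != 0 -> semigroupH m.
Proof.
apply: contraNT => nSm; rewrite poleHE coef_sum big1 // => k _.
rewrite coefMXn; case: ltnP => // le_k; rewrite coef_comp_poly_Xn //.
case: dvdnP => // -[i mk]; case/semigroupHP: nSm; exists i, k.
by rewrite -mk subnK.
Qed.

Lemma poleH_inj u v : poleH u = poleH v <-> u ~ v.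
Proof.
split=> [uv|/eqR_modp]; last by rewrite /poleH => ->.
apply/eqR_modp/polyP => j; case: (ltnP j q) => [ltjq|leqj].
  by apply/polyP => i; move: (poleH_coef u i ltjq); rewrite uv poleH_coef.
by rewrite !nth_default ?(leq_trans (size_modH _)).
Qed.

Lemma poleH_reduced i j : (j < q)%N ->
  poleH (('X^i)%:P * 'X^j) = 'X^(i * q + j * q.+1).
Proof.
move=> ltjq; rewrite /poleH modp_small ?weigh_mono //.
rewrite size_curveH ltnS (leq_trans (size_polyMleq _ _)) // size_polyXn.
by rewrite size_polyC monic_neq0 ?monicXn.
Qed.

Lemma poleH_mono m : semigroupH m -> poleH (monoH m) = 'X^m.
Proof.
by move=> Sm; rewrite poleH_reduced ?semigroupHE // ltn_mod.
Qed.

Lemma degHE p : degH q p = (size (poleH p)).-1.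
Proof.
apply/eqP; rewrite eqn_leq; apply/andP; split.
  apply/bigmax_leqP => j _; apply/bigmax_leqP => i _; case: ifP => // nz.
  have {}nz : (poleH p)`_(i * q + j * q.+1) != 0 by rewrite poleH_coef.
  have lt : (i * q + j * q.+1 < size (poleH p))%N.
    by rewrite ltnNge; apply: contra nz => /leq_sizeP ->.
  by rewrite -ltnS (ltn_predK lt).
have [->|nz] := eqVneq (poleH p) 0; first by rewrite size_poly0.
have lnz : (poleH p)`_(size (poleH p)).-1 != 0 by rewrite -lead_coefE lead_coef_eq0.
have Sm := poleH_supp lnz; set m := (size _).-1 in lnz Sm *.
have ltj : (m %% q < q)%N by rewrite ltn_mod.
rewrite -(semigroupHE Sm) poleH_coef // in lnz.
have lti : (m %/ q - m %% q < size (rowH q p (m %% q)))%N.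
  rewrite ltnNge; apply: contra lnz => le; rewrite /coefH nth_default //.
apply: (leq_trans _ (leq_bigmax (Ordinal ltj))).
apply: (leq_trans _ (leq_bigmax (Ordinal lti))) => /=.
by rewrite /coefnz lnz semigroupHE.
Qed.

Lemma monicHP p : monicH q p -> poleH p != 0.
Proof.
move=> [i [j [ltj [c1 _]]]]; apply/eqP => p0.
by move/eqP: c1; rewrite -poleH_coef // p0 coef0 eq_sym oner_eq0.
Qed.

Lemma eqR_coefH u v i j : u ~ v -> coefH q u i j = coefH q v i j.
Proof. by move=> /eqR_modp uv; rewrite /coefH uv. Qed.

Lemma eqR_degH u v : u ~ v -> degH q u = degH q v.
Proof. by rewrite -poleH_inj !degHE => ->. Qed.

Lemma eqR_monicH u v : u ~ v -> monicH q u -> monicH q v.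
Proof.
move=> uv [i [j [ltj [cu du]]]]; exists i, j.
by rewrite -(eqR_coefH _ _ uv) -(eqR_degH uv).
Qed.

Lemma eqR_mono_sum p : p ~ \sum_(m < size (poleH p)) ((poleH p)`_m)%:P%:P * monoH m.
Proof.
apply/poleH_inj; rewrite poleH_sum -[LHS]coefK poly_def.
apply: eq_bigr => m _; rewrite poleHCM.
have [->|nz] := eqVneq ((poleH p)`_m) 0; first by rewrite !scale0r.
by rewrite poleH_mono // (poleH_supp nz).
Qed.

(* Rewriting [Y^q] as [X^(q+1) - Y] splits a monomial into one of the same
   weight and one of lower weight. *)
Lemma poleH_monomial i j :
  (size (poleH (('X^i)%:P * 'X^j) - 'X^(i * q + j * q.+1))%R
     <= i * q + j * q.+1)%N.
Proof.
elim/ltn_ind: j i => j IH i.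
case: (ltnP j q) => [ltjq|leqj].
  by rewrite poleH_reduced // subrr size_poly0.
have jE : j = (q + (j - q))%N by rewrite subnKC.
have E : ('X^i : {poly F})%:P * 'X^j ~
    ('X^(i + q.+1))%:P * 'X^(j - q) - ('X^i)%:P * 'X^((j - q).+1).
  apply/eqRP; exists (('X^i)%:P * 'X^(j - q)).
  by rewrite {1}jE /curveH exprS !exprD !polyCM; ring.
move/poleH_inj: E => ->; rewrite poleHB.
have lt1 : (j - q < j)%N by lia.
have lt2 : ((j - q).+1 < j)%N by lia.
have w1 : ((i + q.+1) * q + (j - q) * q.+1 = i * q + j * q.+1)%N by nia.
have w2 : (i * q + (j - q).+1 * q.+1 < i * q + j * q.+1)%N by nia.
have /= := IH _ lt1 (i + q.+1)%N; rewrite w1 => h1.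
have h2 := IH _ lt2 i.
rewrite addrAC (leq_trans (size_polyD _ _)) // geq_max h1 size_polyN /=.
rewrite -(subrK 'X^(i * q + (j - q).+1 * q.+1) (poleH (_ * 'X^((j - q).+1)))).
rewrite (leq_trans (size_polyD _ _)) // geq_max size_polyXn w2 andbT.
by rewrite (leq_trans h2) // ltnW.
Qed.

Lemma poleH_monoM m w : semigroupH m -> semigroupH w ->
  (size (poleH (monoH m * monoH w) - 'X^(m + w))%R <= m + w)%N.
Proof.
move=> Sm Sw.
have := poleH_monomial (m %/ q - m %% q + (w %/ q - w %% q)) (m %% q + w %% q).
rewrite !mulnDl addnACA !semigroupHE // (exprD _ (m %/ q - m %% q)) (exprD _ (m %% q)).
by rewrite polyCM mulrACA.
Qed.

(** By bilinearity this reduces to pairs of basis monomials. The bound on the size puts the degree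
    of the error strictly below the sum, so leading terms multiply exactly. *)
Lemma poleHM u v :
  (size (poleH (u * v) - poleH u * poleH v)%R <= degH q u + degH q v)%N.
Proof.
have polyE p : poleH p = \sum_(m < size (poleH p)) (poleH p)`_m *: 'X^m.
  by rewrite -poly_def coefK.
have /poleH_inj -> := eqRM (eqR_mono_sum u) (eqR_mono_sum v).
have -> : poleH u * poleH v = (\sum_(m < size (poleH u)) (poleH u)`_m *: 'X^m) *
    (\sum_(m < size (poleH v)) (poleH v)`_m *: 'X^m) by rewrite -!polyE.
rewrite !mulr_suml poleH_sum -sumrB.
apply: (leq_trans (size_sum _ _ _)); apply/bigmax_leqP => m _.
rewrite !mulr_sumr poleH_sum -sumrB.
apply: (leq_trans (size_sum _ _ _)); apply/bigmax_leqP => k _.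
rewrite mulrACA -!polyCM poleHCM -scalerAl -scalerAr scalerA -exprD -scalerBr.
have [->|] := eqVneq ((poleH u)`_m * (poleH v)`_k) 0.
  by rewrite scale0r size_poly0.
rewrite mulf_eq0 => /norP[/poleH_supp Sm /poleH_supp Sk].
apply: (leq_trans (size_scale_leq _ _)).
apply: (leq_trans (poleH_monoM Sm Sk)); rewrite !degHE.
by have := ltn_ord m; have := ltn_ord k; lia.
Qed.

Lemma degHM_leq u v : (degH q (u * v) <= degH q u + degH q v)%N.
Proof.
rewrite {1}degHE -(subrK (poleH u * poleH v) (poleH (u * v))).
have h : (size (poleH u * poleH v)%R <= (degH q u + degH q v).+1)%N.
  by rewrite (leq_trans (size_polyMleq _ _)) // !degHE; lia.
rewrite -ltnS; set a := (degH q u + _)%N in h *.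
have : (size (poleH (u * v) - poleH u * poleH v + poleH u * poleH v)%R <= a.+1)%N.
  by rewrite (leq_trans (size_polyD _ _)) // geq_max h (leq_trans (poleHM u v)).
by case: (size _).
Qed.

Lemma degH1 : degH q (1 : bpoly) = 0%N.
Proof.
have := poleH_reduced 0 q_gt0; rewrite !expr0 mulr1 polyC1 => p1.
by rewrite degHE p1 size_poly1.
Qed.

Lemma degH_mpow h (a : 'I_h -> bpoly) d (i : mi h) :
  (forall mu, degH q (a mu) <= d)%N -> (degH q (mpow a i) <= mnorm i * d)%N.
Proof.
move=> ad; rewrite /mpow /mnorm big_distrl /=.
elim/big_ind2: _ => [|u1 d1 u2 d2 h1 h2|mu _]; first by rewrite degH1.
  exact: leq_trans (degHM_leq _ _) (leq_add h1 h2).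
elim: (i mu) => [|n IH]; first by rewrite expr0 degH1.
by rewrite exprS mulSn (leq_trans (degHM_leq _ _)) ?leq_add.
Qed.

End CoordinateRing.

(** * Expansions at rational points *)

Section Branches.
Set Implicit Arguments. Unset Strict Implicit. Unset Printing Implicit Defensive.
Variables (F : fieldType) (q : nat).
Hypotheses (q_gt1 : (1 < q)%N) (q_eq0 : q%:R = 0 :> F).
Local Notation curve := (curveH F q).
Implicit Types (P : F * F) (f g u : bpoly F).

(* Newton iteration for [Y^q + Y = X^(q+1)], whose derivative in [Y] is 1:
   [branch P n] is the expansion of [Y] at [P] modulo [(X - a)^(n+1)]. *)
Fixpoint branch P n : {poly F} :=
  if n is n'.+1 then 'X^(q.+1) - branch P n' ^+ q else P.2%:P.

(** [X - a] is a local parameter at [P], so the order of [f] is read off after substituting the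
    expansion of [Y]. [branch P s] is correct to one order more than needed. *)
Definition vanishH P s f : bool := ('X - P.1%:P) ^+ s %| f.[branch P s].

Lemma horner_evH f (y : {poly F}) (a : F) : f.[y].[a] = evH (a, y.[a]) f.
Proof.
rewrite /evH /=; elim/poly_ind: f => [|f c IH]; first by rewrite !horner0.
by rewrite !hornerE IH.
Qed.

Lemma evHM P f g : evH P (f * g) = evH P f * evH P g.
Proof. by rewrite /evH !hornerM. Qed.

Lemma evHB P f g : evH P (f - g) = evH P f - evH P g.
Proof. by rewrite /evH !hornerE. Qed.

Lemma curveH_horner (y : {poly F}) : curve.[y] = y ^+ q + y - 'X^(q.+1).
Proof. by rewrite /curveH !hornerE. Qed.

Lemma branch_at P n : onH q P -> (branch P n).[P.1] = P.2.
Proof.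
move=> /eqP onP; elim: n => [|n IH] /=; first by rewrite hornerC.
by rewrite !hornerE IH -onP addrC addKr.
Qed.

(** This is the quotient of [Y^q - b^q] by [Y - b] evaluated at [b], that is, the derivative of
    [Y^q]. *)
Lemma sumX_exp_diag (b : F) : \sum_(i < q) b ^+ (q.-1 - i) * b ^+ i = 0.
Proof.
rewrite (eq_bigr (fun => b ^+ q.-1)) => [|i _].
  by rewrite sumr_const card_ord -mulr_natl q_eq0 mul0r.
by rewrite -exprD subnK // -ltnS prednK ?ltn_ord // ltnW.
Qed.

(** One iteration turns the value of the curve equation into a difference of two [q]-th powers. Its
    factor [branch P n.+1 - branch P n] is minus the previous value; the cofactor vanishes at [a]
    and gains one order. *)
Lemma branch_curve P n : onH q P -> ('X - P.1%:P) ^+ n.+1 %| curve.[branch P n].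
Proof.
move=> onP; elim: n => [|n IH].
  rewrite expr1 dvdp_XsubCl /root horner_evH hornerC /evH !hornerE.
  by rewrite (eqP onP) subrr.
rewrite curveH_horner [X in _ + X]/= -/(branch P n.+1).
have -> : branch P n.+1 ^+ q + ('X^(q.+1) - branch P n ^+ q) - 'X^(q.+1)
    = branch P n.+1 ^+ q - branch P n ^+ q by ring.
rewrite subrXX exprSr dvdp_mul //.
  have -> : branch P n.+1 - branch P n = - curve.[branch P n].
    by rewrite curveH_horner /=; ring.
  by rewrite dvdpNr.
rewrite dvdp_XsubCl /root horner_sum; apply/eqP.
rewrite -[RHS](sumX_exp_diag P.2); apply: eq_bigr => i _.
by rewrite hornerM !horner_exp !branch_at.
Qed.

Lemma dvdp_sum I (r : seq I) (A : pred I) (d : {poly F}) (D : I -> {poly F}) :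
  (forall i, A i -> d %| D i) -> d %| \sum_(i <- r | A i) D i.
Proof. by move=> dD; elim/big_ind: _ => [|x y|//]; [exact: dvdp0|exact: dvdp_add]. Qed.

Lemma coprimep_XsubC_exp (r : {poly F}) (a : F) s :
  r.[a] != 0 -> coprimep (('X - a%:P) ^+ s) r.
Proof. by move=> ra; rewrite coprimep_expl // coprimep_sym coprimep_XsubC. Qed.

Lemma eqR_vanishH P s f g : onH q P -> eqR q f g -> vanishH P s f -> vanishH P s g.
Proof.
move=> onP /(eqR_sym q_gt1)/(eqRP q_gt1)[t ->]; rewrite /vanishH hornerD hornerM => fP.
rewrite dvdp_add // dvdp_mull //.
by apply: dvdp_trans (branch_curve s onP); rewrite dvdp_exp2l.
Qed.

(** Along the branch both [X - a] and [Y - b] become multiples of [X - a], while [u] stays prime to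
    [X - a] and can be cancelled. *)
Lemma vgeH_vanish P s f : onH q P -> vgeH q P s f -> vanishH P s f.
Proof.
move=> onP [u [uP [c /(eqR_sym q_gt1) E]]].
have cu : coprimep (('X - P.1%:P) ^+ s) u.[branch P s].
  by apply: coprimep_XsubC_exp; rewrite horner_evH branch_at // -surjective_pairing.
rewrite /vanishH -(Gauss_dvdpr _ cu) -hornerM; apply: (eqR_vanishH onP E).
rewrite /vanishH horner_sum; apply: dvdp_sum => k _.
rewrite !hornerM !horner_exp hornerC -mulrA dvdp_mull //.
rewrite -{1}(subnKC (ltnSE (ltn_ord k))) exprD dvdp_mul // dvdp_exp2r //.
by rewrite dvdp_XsubCl /root !hornerE branch_at // subrr.
Qed.

Lemma vanish_vgeH P s f : onH q P -> vanishH P s f -> vgeH q P s f.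
Proof.
move=> onP /dvdpP[d fE]; set y := branch P s in fE.
have /dvdpP[e cE] : ('X - P.1%:P) ^+ s %| curve.[y].
  by apply: dvdp_trans (branch_curve s onP); rewrite dvdp_exp2l.
(* Modulo the curve, [u] turns [Y - y] into [- curve.[y]], a multiple of [(X - a)^s]; its value at
   [P] is 1. *)
pose u : bpoly F := 1 + \sum_(i < q) 'X^(q.-1 - i) * y%:P ^+ i.
have uE : ('X - y%:P) * u = curve - curve.[y]%:P.
  rewrite /u mulrDr mulr1 -subrXX curveH_horner /curveH !polyCB polyCD !polyC_exp.
  by ring.
have /factor_theorem[k kE] : root (f - f.[y]%:P) y.
  by rewrite /root !hornerE subrr.
exists u; split.
  rewrite /u /evH hornerD hornerC horner_sum hornerD hornerC horner_sum.
  rewrite (eq_bigr (fun i : 'I_q => P.2 ^+ (q.-1 - i) * P.2 ^+ i)) => [|i _].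
    by rewrite sumX_exp_diag addr0 oner_neq0.
  by rewrite !hornerE branch_at.
(* Only the pure power [(X - a)^s] among the generators is used. *)
exists (fun i => if i == s then u * d%:P - k * e%:P else 0).
rewrite big_ord_recr /= eqxx subnn expr0 mulr1 big1 ?add0r => [|i _]; last first.
  by rewrite (ltn_eqF (ltn_ord i)) !mul0r.
apply/(eqRP q_gt1); exists k.
have {1}-> : f = k * ('X - y%:P) + f.[y]%:P by rewrite -kE subrK.
rewrite mulrDr mulrCA [u * (_ - _)]mulrC uE cE fE !polyCM !polyC_exp; ring.
Qed.

End Branches.

(** * Jets at several points *)

Section Jets.
Set Implicit Arguments. Unset Strict Implicit. Unset Printing Implicit Defensive.
Variables (F : finFieldType) (q : nat).
Hypotheses (q_gt1 : (1 < q)%N) (q_eq0 : q%:R = 0 :> F).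
Variables (K : finType) (pt : K -> F * F) (s : nat).
Hypothesis pt_on : forall k, onH q (pt k).
Implicit Types (f g : bpoly F).

Let modulus k : {poly F} := ('X - (pt k).1%:P) ^+ s.

(** The target is a finite type, so that dimension arguments become comparisons of cardinals. *)
Definition jets g : {ffun K * 'I_s -> F} :=
  [ffun x : K * 'I_s => (g.[branch q (pt x.1) s] %% modulus x.1)`_x.2].

Let size_modulus k : size (modulus k) = s.+1.
Proof. exact: size_exp_XsubC. Qed.

Lemma jetsE k g (v : {poly F}) :
  (forall i : 'I_s, v`_i = jets g (k, i)) -> (size v <= s)%N ->
  g.[branch q (pt k) s] %% modulus k = v.
Proof.
move=> vE szv; apply/polyP => i; case: (ltnP i s) => [lti|lei].
  by have := vE (Ordinal lti); rewrite ffunE.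
rewrite !nth_default ?(leq_trans szv) //; apply: leq_trans lei.
by rewrite -ltnS -(size_modulus k) ltn_modp -size_poly_eq0 size_modulus.
Qed.

Lemma eq_jetsP g g' : jets g = jets g' <-> forall k, vanishH q (pt k) s (g - g').
Proof.
split=> [gg' k|van].
  rewrite /vanishH hornerD hornerN -/(modulus k) /dvdp modpD modpN subr_eq0.
  rewrite (@jetsE k g (g'.[branch q (pt k) s] %% modulus k)) // => [i|].
    by rewrite gg' ffunE.
  by rewrite -ltnS -(size_modulus k) ltn_modp -size_poly_eq0 size_modulus.
apply/ffunP => -[k i]; rewrite !ffunE /=.
have := van k; rewrite /vanishH hornerD hornerN -/(modulus k) /dvdp modpD modpN.
by rewrite subr_eq0 => /eqP ->.
Qed.

Lemma card_jets : #|{ffun K * 'I_s -> F}| = (#|F| ^ (s * #|K|))%N.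
Proof. by rewrite card_ffun card_prod card_ord mulnC. Qed.

Hypothesis pt_inj : injective pt.

(* The Chinese remainder theorem for the pairwise comaximal powers of the
   maximal ideals at the points [pt k]. *)
Lemma jets_surj (t : {ffun K * 'I_s -> F}) : exists g, jets g = t.
Proof.
(* A line through [pt j] that misses [pt k]: vertical if the abscissae differ, horizontal
   otherwise. *)
pose hyp k j : bpoly F := if (pt j).1 != (pt k).1 then ('X - (pt j).1%:P)%:P
  else 'X - (pt j).2%:P%:P.
pose L k := \prod_(j | j != k) hyp k j ^+ s.
have Lk k : (L k).[branch q (pt k) s].[(pt k).1] != 0.
  rewrite /L !horner_prod; apply/prodf_neq0 => j nejk.
  rewrite !horner_exp expf_neq0 // /hyp; case: ifPn => [ne1|/negPn/eqP e1].
    by rewrite !hornerE subr_eq0 eq_sym.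
  rewrite !hornerE branch_at // subr_eq0; apply: contra nejk => /eqP e2.
  by apply/eqP/pt_inj; rewrite [LHS]surjective_pairing e1 -e2 -surjective_pairing.
have Lj k j : j != k -> modulus j %| (L k).[branch q (pt j) s].
  move=> nejk; rewrite /L horner_prod (bigD1 j) //= dvdp_mulr // horner_exp.
  rewrite dvdp_exp2r // dvdp_XsubCl /root /hyp.
  by case: ifP => _; rewrite !hornerE ?branch_at // subrr.
(* [w k] inverts [L k] along the branch at [pt k], so that [w k * L k] is 1 there and 0 at the other
   points, to order [s]. *)
have /fin_all_exists[w wP] k : exists w : {poly F},
    modulus k %| w * (L k).[branch q (pt k) s] - 1.
  have /Bezout_eq1_coprimepP[[a b] /= ab1] := coprimep_XsubC_exp s (Lk k).
  exists b; rewrite -ab1 opprD addrCA subrr addr0 dvdpNr dvdp_mull //.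
pose v k : {poly F} := \poly_(i < s) (if insub i is Some j then t (k, j) else 0).
pose g := \sum_k (w k * v k)%:P * L k.
exists g; apply/ffunP => -[k i]; rewrite ffunE /=.
suff -> : g.[branch q (pt k) s] %% modulus k = v k.
  by rewrite coef_poly ltn_ord valK.
rewrite -[RHS](@modp_small _ _ (modulus k)) ?size_modulus ?ltnS ?size_poly //.
apply/eqP; rewrite -subr_eq0 -modpN -modpD.
change (modulus k %| g.[branch q (pt k) s] - v k).
rewrite /g horner_sum (bigD1 k) //= addrAC dvdp_add //.
  rewrite hornerM hornerC (_ : _ - _ = v k * (w k * (L k).[branch q (pt k) s] - 1)).
    by rewrite dvdp_mull.
  by ring.
by apply: dvdp_sum => j nejk; rewrite hornerM dvdp_mull // Lj // eq_sym.
Qed.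

End Jets.

(** * The degree of the error locator *)

Section DegreeBounds.
Set Implicit Arguments. Unset Strict Implicit. Unset Printing Implicit Defensive.
Variables (F : finFieldType) (q : nat).
Hypotheses (q_gt1 : (1 < q)%N) (q_eq0 : q%:R = 0 :> F).
Implicit Types (f g : bpoly F) (A : seq nat) (c : nat -> F).

Definition comb A c : bpoly F := \sum_(m <- A) (c m)%:P%:P * monoH F q m.

Lemma poleH_comb A c : all (semigroupH q) A ->
  poleH q (comb A c) = \sum_(m <- A) c m *: 'X^m.
Proof.
move=> /allP SA; rewrite poleH_sum // !big_seq; apply: eq_bigr => m /SA Sm.
by rewrite poleHCM // poleH_mono.
Qed.

Lemma coef_poleH_comb A c m : all (semigroupH q) A -> uniq A -> m \in A ->
  (poleH q (comb A c))`_m = c m.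
Proof.
move=> SA uA mA; rewrite poleH_comb // coef_sum (bigD1_seq m) //=.
rewrite coefZ coefXn eqxx mulr1 big1 ?addr0 // => i nei.
by rewrite coefZ coefXn eq_sym (negPf nei) mulr0.
Qed.

Lemma comb_ext A c c' : {in A, c =1 c'} -> comb A c = comb A c'.
Proof.
by move=> cc'; rewrite /comb !big_seq; apply: eq_bigr => m mA; rewrite cc'.
Qed.

(** Counting needs a finite type of coefficient vectors, indexed by positions in [A], whereas [comb]
    reads coefficients by pole order. *)
Definition lift A (x : {ffun 'I_(size A) -> F}) m : F :=
  if insub (index m A) is Some i then x i else 0.

Lemma lift_nth A (x : {ffun 'I_(size A) -> F}) (i : 'I_(size A)) :
  uniq A -> lift x (nth 0%N A i) = x i.
Proof. by move=> uA; rewrite /lift index_uniq // valK. Qed.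

Lemma lift_restrict A c : {in A, lift [ffun i : 'I_(size A) => c (nth 0%N A i)] =1 c}.
Proof.
move=> m mA; rewrite /lift insubT ?index_mem // => lt.
by rewrite ffunE /= nth_index.
Qed.

(** A gap is [k * q + j] with [k < j < q], and there are ['C(q, 2)] such pairs. *)
Lemma count_gaps N : (count (predC (semigroupH q)) (iota 0 N) <= genus q)%N.
Proof.
have -> : genus q = size [seq (k * q + j)%N | j <- iota 0 q, k <- iota 0 j].
  rewrite size_allpairs_dep (eq_map (g := id)) => [|j]; last exact: size_iota.
  rewrite map_id sumnE /genus divn2 subn1 -bin2 -bin2_sum /index_iota subn0 //.
rewrite -size_filter; apply: uniq_leq_size; first by rewrite filter_uniq ?iota_uniq.
move=> m; rewrite mem_filter /= /semigroupH -ltnNge => /andP[lt _].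
apply/allpairsPdep; exists (m %% q)%N, (m %/ q)%N.
by rewrite !mem_iota /= !add0n lt ltn_mod (ltnW q_gt1) -divn_eq.
Qed.

Section Points.
Variables (K : finType) (pt : K -> F * F) (s : nat).
Hypothesis pt_on : forall k, onH q (pt k).

Lemma exists_vanishH : exists2 g, ~ eqR q g 0 &
  (forall k, vanishH q (pt k) s g) /\ (degH q g <= s * #|K| + genus q)%N.
Proof.
set M := (_ + _)%N; pose A := [seq m <- iota 0 M.+1 | semigroupH q m].
have SA : all (semigroupH q) A by apply: filter_all.
have uA : uniq A by rewrite filter_uniq ?iota_uniq.
(* Of the [s * #|K| + genus q + 1] integers up to [M], at most [genus q] are gaps. *)
have szA : (s * #|K| < size A)%N.
  have := count_predC (semigroupH q) (iota 0 M.+1); have := count_gaps M.+1.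
  rewrite /A size_filter size_iota.
  by set a := count _ _; set b := count _ _; rewrite /M; lia.
pose phi (x : {ffun 'I_(size A) -> F}) := jets q pt s (comb A (lift x)).
(* Pigeonhole: there are more coefficient vectors than jets, and the difference of two combinations
   with equal jets vanishes at all points. *)
have /injectivePn[x [y nexy /eq_jetsP van]] : ~~ injectiveb phi.
  apply: contraL szA => /injectiveP/leq_card.
  rewrite card_jets card_ffun card_ord leq_exp2l ?card_finNzRing_gt1 //.
  by rewrite -leqNgt.
exists (comb A (lift x) - comb A (lift y)); last split=> //.
  move/(poleH_inj q_gt1); rewrite poleHB // poleH0 // => /eqP; rewrite subr_eq0 => /eqP xy.
  case/eqP: nexy; apply/ffunP => i; rewrite -!(lift_nth _ _ uA).
  by rewrite -(coef_poleH_comb (lift x) SA uA) ?mem_nth // xy coef_poleH_comb ?mem_nth.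
rewrite degHE // poleHB // -subn1 leq_subLR add1n.
rewrite (leq_trans (size_polyD _ _)) // geq_max size_polyN.
suff szc c : (size (poleH q (comb A c)) <= M.+1)%N by rewrite (szc (lift x)) (szc (lift y)).
rewrite poleH_comb // big_seq (leq_trans (size_sum _ _ _)) //.
apply/bigmax_leqP_seq => m mA _; rewrite (leq_trans (size_scale_leq _ _)) //.
by move: mA; rewrite size_polyXn mem_filter mem_iota => /and3P[].
Qed.

Hypothesis pt_inj : injective pt.
Variable Lam : bpoly F.
Hypothesis Lam_neq0 : poleH q Lam != 0.
Let d := degH q Lam.

Let lead_Lam : (poleH q Lam)`_d != 0.
Proof. by rewrite /d degHE // -lead_coefE lead_coef_eq0. Qed.

Let semigroup_d : semigroupH q d. Proof. exact: poleH_supp lead_Lam. Qed.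

(* The pole orders not of the form [d + m] with [m] in the semigroup: an Apery
   set, with at most one element in each residue class modulo [d]. *)
Let apery := [seq m <- iota 0 (d + q ^ 2) |
  semigroupH q m && ~~ ((d <= m) && semigroupH q (m - d))%N].

(** If [m < m'] are congruent modulo [d], then [m' - d] is [m] plus a multiple of [d], hence in the
    semigroup, which excludes [m']. For [d = 0] nothing is left. *)
Let size_apery : (size apery <= d)%N.
Proof.
have [d0|d_gt0] := posnP d.
  rewrite /apery (eq_filter (a2 := pred0)) ?filter_pred0 // => m.
  by rewrite /= d0 subn0 andbN.
rewrite -[X in (_ <= X)%N](size_iota 0) -(size_map (modn^~ d)).
apply: uniq_leq_size; last first.
  by move=> _ /mapP[m _ ->]; rewrite mem_iota /= ltn_mod.
rewrite map_inj_in_uniq ?filter_uniq ?iota_uniq //.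
suff lt m m' : m \in apery -> m' \in apery -> (m = m' %[mod d])%N -> ~~ (m < m')%N.
  move=> m m' mA m'A mm'; case: (ltngtP m m') => // ltmm'.
    by case/negP: (lt _ _ mA m'A mm').
  by case/negP: (lt _ _ m'A mA (esym mm')).
rewrite !mem_filter => /andP[/andP[Sm _] _] /andP[/andP[_ nS] _] mm'.
apply: contra nS => ltmm'.
have /dvdnP[k kE] : (d %| m' - m)%N by rewrite -eqn_mod_dvd ?mm' // ltnW.
have m'E : m' = (m + k * d)%N by rewrite -kE subnKC // ltnW.
have k_gt0 : (0 < k)%N by case: k m'E {kE} => // m'E; rewrite m'E addn0 ltnn in ltmm'.
have -> : (m' - d = m + k.-1 * d)%N.
  by rewrite m'E -{1}(prednK k_gt0) mulSn addnCA addKn.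
apply/andP; split; first by rewrite m'E -(prednK k_gt0) mulSn addnCA leq_addr.
elim: (k.-1) => [|n IH]; first by rewrite addn0.
by rewrite mulSn addnCA semigroupHD.
Qed.

(** Division with remainder by leading terms: a top term of order [N.-1] is cancelled by a multiple
    of [Lam] if [N.-1 - d] is in the semigroup, and otherwise goes to the remainder. *)
Let reduce g : exists h c, eqR q g (Lam * h + comb apery c).
Proof.
have [N] := ubnP (size (poleH q g)); elim: N g => // N IH g; rewrite ltnS => szg.
have drop b : (poleH q b)`_N.-1 != 0 -> (size (poleH q b) <= N)%N -> (0 < N)%N ->
    exists a h c, eqR q g (Lam * h + comb apery c + a%:P%:P * b).
  move=> lb szb N_gt0; pose a := (poleH q g)`_N.-1 / (poleH q b)`_N.-1.
  have [|h [c E]] := IH (g - a%:P%:P * b).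
    rewrite -[X in (_ < X)%N](prednK N_gt0) ltnS; apply/leq_sizeP => j.
    rewrite leq_eqVlt poleHB // poleHCM // coefB coefZ => /orP[/eqP <-|ltj].
      by rewrite divfK // subrr.
    by rewrite !nth_default ?mulr0 ?subrr // (leq_trans _ ltj) // prednK.
  exists a, h, c; rewrite -[X in eqR q X _](subrK (a%:P%:P * b) g).
  by apply: eqRD => //; apply: eqRxx.
have [g0|gN0] := eqVneq ((poleH q g)`_N.-1) 0.
  case: (posnP N) => [N0|N_gt0].
    exists 0, (fun => 0); apply/(poleH_inj q_gt1).
    rewrite mulr0 add0r /comb big1 => [|m _]; last by rewrite mul0r.
    by apply/eqP; rewrite poleH0 // -size_poly_leq0 -N0.
  apply: IH; rewrite -[X in (_ < X)%N](prednK N_gt0) ltnS; apply/leq_sizeP => j.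
  rewrite leq_eqVlt => /orP[/eqP <- //|ltj].
  by rewrite nth_default // (leq_trans szg) // -(prednK N_gt0).
have Sn := poleH_supp q_gt1 gN0.
have N_gt0 : (0 < N)%N.
  rewrite lt0n; apply: contraNneq gN0 => N0.
  by move: szg; rewrite N0 leqn0 size_poly_eq0 => /eqP ->; rewrite coef0.
have [/andP[led Sd]|nA] := boolP ((d <= N.-1) && semigroupH q (N.-1 - d))%N.
  pose b := Lam * monoH F q (N.-1 - d).
  (* The error term has degree below [N.-1], so the coefficient of [b] there is the leading one of
     [Lam]. *)
  have := poleHM q_gt1 Lam (monoH F q (N.-1 - d)).
  rewrite -/b -/d degHE // poleH_mono // size_polyXn subnKC // => szB.
  have lb : (poleH q b)`_N.-1 != 0.
    rewrite -(subrK (poleH q Lam * 'X^(N.-1 - d)) (poleH q b)) coefD.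
    rewrite (leq_sizeP _ _ szB) // add0r coefMXn ltnNge leq_subr /= subKn //.
  have szb : (size (poleH q b) <= N)%N.
    rewrite -(subrK (poleH q Lam * 'X^(N.-1 - d)) (poleH q b)).
    rewrite (leq_trans (size_polyD _ _)) // geq_max (leq_trans szB (leq_pred N)) /=.
    have szL : (size (poleH q Lam) <= d.+1)%N by rewrite /d degHE // leqSpred.
    rewrite (leq_trans (size_polyMleq _ _)) // size_polyXn addnS /=.
    move: (size _) szL led N_gt0 => L; lia.
  have [a [h [c E]]] := drop b lb szb N_gt0.
  exists (h + a%:P%:P * monoH F q (N.-1 - d)), c; move: E.
  by rewrite /b addrAC mulrDr mulrCA.
(* The cut-off [d + q ^ 2] loses nothing: every integer from [q ^ 2] on is in the semigroup. *)
have NA : N.-1 \in apery.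
  rewrite mem_filter Sn nA mem_iota /= add0n ltnNge; apply: contra nA => le.
  rewrite (leq_trans (leq_addr _ _) le) /semigroupH.
  rewrite (leq_trans (ltnW (ltn_pmod _ (ltnW q_gt1)))) // leq_divRL ?(ltnW q_gt1) //.
  by rewrite mulnn leq_subRL ?(leq_trans (leq_addr _ _) le).
have [| |//|a [h [c E]]] := drop (monoH F q N.-1).
- by rewrite poleH_mono // coefXn eqxx oner_neq0.
- by rewrite poleH_mono // size_polyXn prednK.
exists h, (fun m => c m + a *+ (m == N.-1)); apply: (eqR_trans q_gt1 E).
rewrite -addrA; apply/(poleH_inj q_gt1); congr (poleH q (_ + _)).
rewrite /comb [RHS](eq_bigr (fun m => (c m)%:P%:P * monoH F q m +
    (a *+ (m == N.-1))%:P%:P * monoH F q m)) => [|m _]; last first.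
  by rewrite !polyCD mulrDl.
rewrite big_split /=; congr (_ + _).
rewrite (bigD1_seq N.-1) ?filter_uniq ?iota_uniq //= eqxx mulr1n.
by rewrite big1 ?addr0 // => m /negPf ->; rewrite mulr0n mul0r.
Qed.

(** Multiples of [Lam] have zero jets, so by [reduce] the combinations over [apery] already realise
    all jets; comparing cardinals bounds [s * #|K|] by the size of [apery]. *)
Lemma leq_degH_vanish : (forall k, vanishH q (pt k) s Lam) -> (s * #|K| <= d)%N.
Proof.
move=> vanLam; apply: leq_trans size_apery.
rewrite -(leq_exp2l _ _ (card_finNzRing_gt1 F)) -card_jets.
rewrite -[X in (_ ^ X)%N]card_ord -card_ffun.
pose phi (x : {ffun 'I_(size apery) -> F}) := jets q pt s (comb apery (lift x)).
suff /fin_all_exists[psi psiK] t : exists x, phi x = t.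
  by apply: (leq_card psi (can_inj psiK)).
have [g gt] := jets_surj pt_on pt_inj t.
have [h [c gE]] := reduce g.
exists [ffun i : 'I_(size apery) => c (nth 0%N apery i)]; rewrite -gt /phi; apply/eq_jetsP => k.
rewrite (comb_ext (lift_restrict c)).
have E : eqR q (- (Lam * h)) (comb apery c - g).
  have := eqRB q_gt1 (eqRxx q_gt1 (comb apery c)) gE.
  by rewrite opprD addrCA subrr addr0 => /(eqR_sym q_gt1).
apply: (eqR_vanishH q_gt1 q_eq0 (pt_on k) E).
by rewrite /vanishH hornerN hornerM dvdpNr dvdp_mulr //; apply: vanLam.
Qed.

End Points.
End DegreeBounds.

(** * Divisibility by [G] *)

Section RationalPoints.
Set Implicit Arguments. Unset Strict Implicit. Unset Printing Implicit Defensive.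

(** The sum of all elements is unchanged when each is shifted by 1. *)
Lemma natr_card_eq0 (F : finFieldType) : #|F|%:R = 0 :> F.
Proof.
have : \sum_(x : F) x = \sum_(x : F) (1 + x) by rewrite [LHS](reindex_inj (addrI 1)).
rewrite big_split /= sumr_const => /eqP.
by rewrite -subr_eq0 opprD addrCA subrr addr0 oppr_eq0 => /eqP.
Qed.

Variables (F : finFieldType) (q : nat).
Hypotheses (q_gt1 : (1 < q)%N) (q_eq0 : q%:R = 0 :> F).
Hypothesis cardF : #|F| = (q ^ 2)%N.
Local Notation curve := (curveH F q).
Implicit Types (g : bpoly F).

Lemma eqR_evH Q g g' : onH q Q -> eqR q g g' -> evH Q g = evH Q g'.
Proof.
move=> /eqP onQ /(eqRP q_gt1)[t ->].
rewrite /evH [in LHS]hornerD hornerM curveH_horner !hornerE.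
by rewrite onQ subrr mulr0 addr0.
Qed.

Lemma Gpoly_prod : 'X^(q ^ 2) - 'X = \prod_(x : F) ('X - x%:P) :> {poly F}.
Proof. by rewrite -cardF finField_genPoly. Qed.

(* [G] has a simple zero at every rational point. *)
Lemma evH_vanish_G Q s n g : onH q Q -> (n < s)%N ->
  vanishH q Q s (Gpoly F q ^+ n * g) -> evH Q g = 0.
Proof.
move=> onQ ltns; rewrite /vanishH hornerM horner_exp hornerC Gpoly_prod.
rewrite (bigD1 Q.1) //=; set G1 := \prod_(i | _) _.
have G1Q : G1.[Q.1] != 0.
  rewrite horner_prod; apply/prodf_neq0 => x nex.
  by rewrite hornerXsubC subr_eq0 eq_sym.
rewrite exprMn -mulrA => /(dvdp_trans (dvdp_exp2l _ ltns)).
rewrite exprSr dvdp_mul2l ?expf_neq0 ?polyXsubC_eq0 // dvdp_XsubCl /root.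
rewrite hornerM horner_exp mulf_eq0 expf_eq0 (negPf G1Q) andbF /=.
by rewrite horner_evH branch_at // -surjective_pairing => /eqP.
Qed.

Variable P : 'I_(q ^ 3) -> F * F.
Hypotheses (P_on : forall k, onH q (P k)) (P_inj : injective P).

(* There are [q^2] fibres of the [X]-coordinate, each with at most [q] of the
   [q^3] points, so each has exactly [q]. *)
Lemma card_fibre (a : F) : #|[set y | onH q (a, y)]| = q.
Proof.
have fibre_leq (b : F) :
    (#|[set y | onH q (b, y)]| <= q ?= iff (#|[set y | onH q (b, y)]| == q))%N.
  split=> //; rewrite -ltnS cardE.
  pose r : {poly F} := 'X^q + ('X - (b ^+ q.+1)%:P).
  have szr : size r = q.+1 by rewrite size_polyDl ?size_polyXn ?size_XsubC.
  rewrite -szr; apply: max_poly_roots; rewrite ?enum_uniq //.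
    by rewrite -size_poly_eq0 szr.
  apply/allP => y; rewrite mem_enum inE => /eqP /= onb.
  by rewrite /root /r hornerD hornerXn hornerXsubC addrA onb subrr.
have total : (q ^ 3 <= \sum_(b : F) #|[set y | onH q (b, y)]|)%N.
  rewrite (eq_bigr (fun b => \sum_(y | onH q (b, y)) 1)%N) => [|b _]; last first.
    by rewrite -sum1_card; apply: eq_bigl => y; rewrite inE.
  rewrite pair_big_dep /= sum1_card -[X in (X <= _)%N]card_ord -(card_imset _ P_inj).
  apply/subset_leq_card/subsetP => _ /imsetP[k _ ->].
  by rewrite unfold_in /=; exact: P_on.
have := leqif_sum (P := predT) (fun b _ => fibre_leq b).
rewrite sum_nat_const cardF -expnSr => -[le eq3].
by move: eq3; rewrite eqn_leq le total => /esym/forall_inP/(_ a isT)/eqP.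
Qed.

(** The reduced form has degree less than [q] in [Y], but at each [X = a] it has the [q] roots of
    the fibre. So its coefficients vanish at every [a] and are divisible by [G]. *)
Lemma dvd_Gpoly g : (forall k, evH (P k) g = 0) ->
  (forall Q : F * F, onH q Q -> exists k, P k = Q) ->
  exists t, eqR q g (Gpoly F q * t).
Proof.
move=> gP Pall; set p := g %% curve; have gp : eqR q g p := eqR_nf q_gt1 g.
have szp : (size p <= q)%N := size_modH q_gt1 g.
have pa0 a j : (p`_j).[a] = 0.
  pose pa := map_poly (horner_eval a) p.
  suff -> : (p`_j).[a] = pa`_j.
    suff -> : pa = 0 by rewrite coef0.
    apply/eqP; apply: contraTT szp => pa_n0; rewrite -ltnNge.
    have szpa : (size pa <= size p)%N by apply: size_poly.
    apply: leq_trans szpa; suff : (#|[set y | onH q (a, y)]| < size pa)%N by rewrite card_fibre.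
    rewrite cardE; apply: max_poly_roots; rewrite ?enum_uniq //.
    apply/allP => y; rewrite mem_enum inE => ony.
    have [k Pk] := Pall _ ony.
    have yE : horner_eval a y%:P = y by rewrite /horner_eval hornerC.
    rewrite /root -[X in _.[X]]yE horner_map -[X in X == _]/(evH (a, y) p).
    by rewrite -(eqR_evH ony gp) -Pk gP.
  by rewrite coef_map.
have Gp j : 'X^(q ^ 2) - 'X %| p`_j.
  rewrite Gpoly_prod -big_enum; apply: uniq_roots_dvdp.
    by apply/allP => x _; rewrite /root pa0.
  by rewrite uniq_rootsE enum_uniq.
exists (\poly_(j < q) (p`_j %/ ('X^(q ^ 2) - 'X))); apply: (eqR_trans q_gt1 gp).
suff pE : p = Gpoly F q * \poly_(j < q) (p`_j %/ ('X^(q ^ 2) - 'X)).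
  by rewrite -pE; apply: eqRxx.
apply/polyP => j; rewrite coefCM coef_poly; case: ltnP => [_|le].
  by rewrite mulrC divpK.
by rewrite mulr0 nth_default // (leq_trans szp).
Qed.

End RationalPoints.

(** * Multi-indices *)

Section MultiIndices.
Set Implicit Arguments. Unset Strict Implicit. Unset Printing Implicit Defensive.
Variables (T : comNzRingType) (h : nat).
Implicit Types (a b : 'I_h -> T) (i j k : mi h).

Lemma leq_mnorm j mu : (j mu <= mnorm j)%N.
Proof. by rewrite /mnorm (bigD1 mu) //= leq_addr. Qed.

Lemma mle_mnorm i j : mle i j -> (mnorm i <= mnorm j)%N.
Proof. by move=> /forallP ij; apply: leq_sum => mu _. Qed.

Lemma mbinom_eq0 i j : ~~ mle i j -> mbinom j i = 0%N.
Proof.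
rewrite negb_forall => /existsP[mu]; rewrite -ltnNge => lt.
by rewrite /mbinom (bigD1 mu) //= bin_small.
Qed.

Lemma mnorm_m0 : mnorm (m0 h) = 0%N.
Proof. by rewrite /mnorm big1 // => mu _; rewrite ffunE. Qed.

Lemma mpow_m0 a : mpow a (m0 h) = 1.
Proof. by rewrite /mpow big1 // => mu _; rewrite ffunE. Qed.

Definition mdec k mu : mi h := [ffun nu => (k nu - (nu == mu))%N].

Lemma mnorm_mdec k mu : (0 < k mu)%N -> mnorm k = (mnorm (mdec k mu)).+1.
Proof.
move=> kmu; rewrite /mnorm (bigD1 mu) //= [in RHS](bigD1 mu) //= ffunE eqxx subn1.
rewrite -addSn prednK //; congr (_ + _)%N; apply: eq_bigr => nu /negPf ne.
by rewrite ffunE ne subn0.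
Qed.

Lemma mpow_mdec a k mu : (0 < k mu)%N -> mpow a k = mpow a (mdec k mu) * a mu.
Proof.
move=> kmu; rewrite /mpow (bigD1 mu) //= [in RHS](bigD1 mu) //= ffunE eqxx subn1.
rewrite mulrAC -exprSr prednK //; congr (_ * _); apply: eq_bigr => nu /negPf ne.
by rewrite ffunE ne subn0.
Qed.

Lemma mnorm_gt0 k : (0 < mnorm k)%N -> exists mu, (0 < k mu)%N.
Proof.
rewrite lt0n /mnorm sum_nat_eq0 negb_forall => /existsP[mu].
by rewrite /= -lt0n; exists mu.
Qed.

(** The product of the one-variable binomial expansions, over a box of any side [N] exceeding the
    entries of [j]; the added terms have binomial coefficient 0. *)
Lemma mpowD a b j N : (forall mu, j mu < N)%N ->
  mpow (fun mu => a mu + b mu) j =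
  \sum_(k : {ffun 'I_h -> 'I_N})
     (mbinom j (ofI k))%:R * mpow b (msub j (ofI k)) * mpow a (ofI k).
Proof.
move=> ltjN; pose E mu (i : 'I_N) := 'C(j mu, i)%:R * b mu ^+ (j mu - i) * a mu ^+ i.
rewrite /mpow (eq_bigr (fun mu => \sum_(i < N) E mu i)) => [|mu _].
  rewrite bigA_distr_bigA /=; apply: eq_bigr => k _.
  rewrite /E !big_split /= /mbinom natr_prod; congr (_ * _ * _); apply: eq_bigr => mu _;
    by rewrite !ffunE.
rewrite addrC exprDn.
rewrite (big_ord_widen _
  (fun i : nat => b mu ^+ (j mu - i) * a mu ^+ i *+ 'C(j mu, i)) (ltjN mu)).
rewrite big_mkcond; apply: eq_bigr => i _; rewrite /E ltnS.
case: leqP => [_|lt]; first by rewrite -mulr_natl mulrA.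
by rewrite bin_small // !mul0r.
Qed.

(* Multi-indices of norm less than [s] have all entries less than [s]. *)
Lemma sum_mnorm_widen s N (E : mi h -> T) : (s <= N)%N ->
  \sum_(k : {ffun 'I_h -> 'I_s} | (mnorm (ofI k) < s)%N) E (ofI k) =
  \sum_(k : {ffun 'I_h -> 'I_N} | (mnorm (ofI k) < s)%N) E (ofI k).
Proof.
move=> lesN; case: (posnP s) => [s0|s_gt0].
  have none M (k : {ffun 'I_h -> 'I_M}) : (mnorm (ofI k) < s)%N = false.
    by apply/negbTE; rewrite -leqNgt; apply: leq_trans (leq0n _); rewrite s0.
  by rewrite !big_pred0.
pose up (k : {ffun 'I_h -> 'I_s}) : {ffun 'I_h -> 'I_N} := [ffun mu => widen_ord lesN (k mu)].
pose dn (k : {ffun 'I_h -> 'I_N}) : {ffun 'I_h -> 'I_s} :=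
  [ffun mu => insubd (Ordinal s_gt0) (k mu : nat)].
have upE (k : {ffun 'I_h -> 'I_s}) : ofI (up k) = ofI k by apply/ffunP => mu; rewrite !ffunE.
rewrite [RHS](reindex_onto up dn) => [|k lts].
  apply: eq_big => [k|k _]; last by rewrite upE.
  rewrite upE andbC; case: eqP => //= [[]]; apply/ffunP => mu.
  by rewrite !ffunE /= valKd.
apply/ffunP => mu; apply: val_inj; rewrite !ffunE /= insubdK //.
by apply: leq_ltn_trans lts; have := leq_mnorm (ofI k) mu; rewrite ffunE.
Qed.

End MultiIndices.

(** * The key equations *)

Section KeyEquations.
Set Implicit Arguments. Unset Strict Implicit. Unset Printing Implicit Defensive.
Variables (F : finFieldType) (q : nat).
Hypotheses (q_gt1 : (1 < q)%N) (q_eq0 : q%:R = 0 :> F) (cardF : #|F| = (q ^ 2)%N).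
Variable P : 'I_(q ^ 3) -> F * F.
Hypotheses (P_on : forall k, onH q (P k)) (P_inj : injective P)
  (P_all : forall Q : F * F, onH q Q -> exists k, P k = Q).
Variables (h s : nat) (f Rv : 'I_h -> bpoly F) (E : {set 'I_(q ^ 3)}).
Variables (Lam : bpoly F) (Om : mi h -> bpoly F).
Let dif mu := f mu - Rv mu.
Hypotheses (s_gt0 : (0 < s)%N)
  (Lam_E : forall k, k \in E -> vanishH q (P k) s Lam)
  (dif_nE : forall k mu, k \notin E -> evH (P k) (dif mu) = 0)
  (Om_eq : forall i, (mnorm i < s)%N ->
     eqR q (Lam * mpow dif i) (Gpoly F q ^+ mnorm i * Om i)).

(* For [|i| = s - 1], [Om i] vanishes on [E] because [Lam] vanishes there to
   order [s] while [G^(s-1)] only accounts for [s - 1]; so [Om i * dif mu]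
   vanishes at all rational points and is divisible by [G]. *)
Lemma error_locator_dvd i : (s <= mnorm i)%N ->
  exists t, eqR q (Lam * mpow dif i) (Gpoly F q ^+ s * t).
Proof.
have [N] := ubnP (mnorm i); elim: N i => // N IH i ltN les.
have [mu imu] := mnorm_gt0 (leq_trans s_gt0 les).
have nE := mnorm_mdec imu; rewrite (mpow_mdec dif imu) mulrA.
(* Above norm [s] the extra factor is simply carried along; norm exactly [s] is the real case. *)
have := les; rewrite nE leq_eqVlt => /orP[/eqP sE|lts]; last first.
  have [||t tE] := IH (mdec i mu) => //; first by rewrite -ltnS -nE.
  by exists (t * dif mu); rewrite mulrA; apply: eqRM => //; apply: eqRxx.
have ltm : (mnorm (mdec i mu) < s)%N by rewrite sE.
have [|t tE] := dvd_Gpoly q_gt1 cardF P_on P_inj (g := Om (mdec i mu) * dif mu) _ P_all.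
  move=> k; rewrite evHM; have [kE|/dif_nE ->] := boolP (k \in E); last by rewrite mulr0.
  rewrite (evH_vanish_G cardF (P_on k) ltm) ?mul0r //.
  apply: (eqR_vanishH q_gt1 q_eq0 (P_on k) (Om_eq ltm)).
  by rewrite /vanishH hornerM dvdp_mulr //; apply: Lam_E.
exists t; rewrite [X in _ ^+ X]sE exprSr.
apply: (eqR_trans q_gt1 (eqRM q_gt1 (Om_eq ltm) (eqRxx q_gt1 (dif mu)))).
by rewrite -!mulrA; apply: eqRM => //; apply: eqRxx.
Qed.

(** Both kinds of equation at once: [t = 0] turns the congruence into an equality. For [mnorm j < s]
    no index of norm at least [s] lies below [j], so the remaining terms have zero binomials. *)
Lemma key_equation (j : mi h) : exists2 t, 
  eqR q (Lam * mpow f j - sumI q s Rv Om j) (Gpoly F q ^+ s * t) &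
  (mnorm j < s)%N -> t = 0.
Proof.
(* A box holding both the indices of [sumI] and all those below [j]. *)
pose N := maxn s (mnorm j).+1.
have ltN mu : (j mu < N)%N by rewrite leq_max ltnS leq_mnorm orbT.
have -> : mpow f j = mpow (fun mu => dif mu + Rv mu) j.
  by rewrite /mpow; apply: eq_bigr => mu _; rewrite subrK.
rewrite (mpowD dif Rv ltN) mulr_sumr.
rewrite /sumI (sum_mnorm_widen (fun k => Om k * Acoef q Rv k j) (leq_maxl s (mnorm j).+1)) -/N.
pose T (k : {ffun 'I_h -> 'I_N}) :=
  Lam * ((mbinom j (ofI k))%:R * mpow Rv (msub j (ofI k)) * mpow dif (ofI k)).
set S := \sum_(k : {ffun 'I_h -> 'I_N} | (mnorm (ofI k) < s)%N) _ * _.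
have low : eqR q (\sum_(k | (mnorm (ofI k) < s)%N) T k) S.
  apply: eqR_sum => // k lts; rewrite /T /Acoef.
  case: (boolP (mle _ _)) => [_|/mbinom_eq0 ->]; last first.
    by rewrite !(mul0r, mulr0); apply: eqRxx.
  set B := _ * mpow Rv _; rewrite mulrCA [Om _ * _]mulrCA [Om _ * _]mulrC.
  by apply: eqRM (Om_eq lts) => //; apply: eqRxx.
have [t tE t0] : exists2 t,
    eqR q (\sum_(k | ~~ (mnorm (ofI k) < s)%N) T k) (Gpoly F q ^+ s * t) &
    (mnorm j < s)%N -> t = 0.
  elim/big_rec: _ => [|k x nlt [t tE t0]].
    by exists 0; rewrite // mulr0; apply: eqRxx.
  rewrite -leqNgt in nlt; have [ltj|lej] := ltnP (mnorm j) s.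
    exists 0 => //; rewrite mulr0 -[0]addr0; apply: eqRD => //.
      rewrite /T mbinom_eq0 ?mul0r ?mulr0; first exact: eqRxx.
      by apply/negP => /mle_mnorm; rewrite leqNgt (leq_trans ltj nlt).
    by move: tE; rewrite t0 // mulr0.
  have [u uE] := error_locator_dvd nlt.
  exists ((mbinom j (ofI k))%:R * mpow Rv (msub j (ofI k)) * u + t) => //.
  rewrite mulrDr /T; apply: eqRD => //.
  rewrite mulrCA [Gpoly _ _ ^+ _ * _]mulrCA.
  by apply: eqRM => //; apply: eqRxx.
exists t => //; rewrite (bigID (fun k : {ffun 'I_h -> 'I_N} => mnorm (ofI k) < s)%N) /= addrAC.
rewrite -[X in eqR q _ X]add0r; apply: eqRD => //.
by have := eqRB q_gt1 low (eqRxx q_gt1 S); rewrite subrr.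
Qed.

End KeyEquations.

(** * The solution of Problem 1 and its degree *)

Theorem theorem3 (F : finFieldType) (q : nat) (hF : #|F| = (q ^ 2)%N)
  (P : 'I_(q ^ 3) -> F * F)
  (hPon : forall k, onH q (P k)) (hPinj : injective P)
  (hPall : forall Q : F * F, onH q Q -> exists k, P k = Q)
  (h mH : nat) (hh : (0 < h)%N)
  (hmH1 : (2 * (genus q - 1) < mH)%N) (hmH2 : (mH < q ^ 3)%N)
  (f : 'I_h -> bpoly F) (hf : forall mu, (degH q (f mu) <= mH)%N)
  (e : 'M[F]_(h, q ^ 3))
  (Rv : 'I_h -> bpoly F)
  (hRdeg : forall mu, (degH q (Rv mu) < q ^ 3 + 2 * genus q)%N)
  (hRev : forall mu k, evH (P k) (Rv mu) = evH (P k) (f mu) + e mu k)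
  (s l : nat) (hs : (0 < s)%N) (hsl : (s <= l)%N)
  (Lam : bpoly F) (hLam : isLambda q P (errset e) s Lam)
  (Om : mi h -> bpoly F)
  (hOm : forall i : mi h, (mnorm i < s)%N ->
     (degH q (Om i) <= degH q Lam + mnorm i * (2 * genus q - 1))%N /\
     eqR q (Lam * mpow (fun mu => f mu - Rv mu) i) (Gpoly F q ^+ mnorm i * Om i)) :
  isSolution q s l mH Rv Om (fun j => Lam * mpow f j) /\
  degH q (Om (m0 h)) = degH q Lam /\
  (s * #|errset e| <= degH q Lam <= s * #|errset e| + genus q)%N.
Proof.
have q_gt1 : (1 < q)%N.
  by have := card_finNzRing_gt1 F; rewrite hF; case: (q) => [|[|]].
have q_eq0 : q%:R = 0 :> F.
  by apply/eqP; have /eqP := natr_card_eq0 F; rewrite hF natrX expf_eq0.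
have [Lam_monic [Lam_vge Lam_min]] := hLam.
have Lam_van k : k \in errset e -> vanishH q (P k) s Lam.
  by move=> kE; apply: (vgeH_vanish q_gt1 q_eq0 (hPon k)); apply: Lam_vge.
have dif_nE k mu : k \notin errset e -> evH (P k) (f mu - Rv mu) = 0.
  rewrite inE negbK => /eqP/matrixP/(_ mu 0); rewrite !mxE => ek0.
  by rewrite evHB hRev ek0 addr0 subrr.
have Om_eq i (lti : (mnorm i < s)%N) := proj2 (hOm i lti).
(* For the zero index the defining relation reads [Lam = Om (m0 h)] in the coordinate ring; degree
   and monicity carry over. *)
have Om0 : eqR q Lam (Om (m0 h)).
  have := Om_eq (m0 h); rewrite mnorm_m0 => /(_ hs).
  by rewrite mpow_m0 mulr1 expr0 mul1r.
have degOm0 := eqR_degH q_gt1 Om0.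
have key := key_equation q_gt1 q_eq0 hF hPon hPinj hPall hs Lam_van dif_nE Om_eq.
pose pt (k : {k | k \in errset e}) := P (val k).
have cardE : #|{: {k | k \in errset e}}| = #|errset e| by rewrite card_sig; apply: eq_card.
split; last split=> //.
  split; first exact: (eqR_monicH q_gt1 Om0 Lam_monic).
  split=> [j _ ltj|].
    have [t tE t0] := key j; move: tE; rewrite t0 // mulr0.
    by rewrite /eqR subr0.
  split=> [j _ _|]; first by have [t tE _] := key j; exists t.
  split=> [i lti|j _]; first by rewrite -degOm0; have [] := hOm i lti.
  rewrite -degOm0; apply: leq_trans (degHM_leq q_gt1 _ _) _.
  by rewrite leq_add2l; apply: degH_mpow.
apply/andP; split.
  rewrite -cardE; apply: (@leq_degH_vanish _ _ q_gt1 q_eq0 _ pt).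
  - by move=> k; apply: hPon.
  - by move=> k k' /hPinj/val_inj.
  - exact: (monicHP q_gt1 Lam_monic).
  - by move=> k; apply: Lam_van; apply: valP.
(* A nonzero competitor of small degree; minimality of [Lam] gives the upper bound. *)
have [g gN0 [gvan gdeg]] := exists_vanishH q_gt1 pt s.
rewrite cardE in gdeg; apply: leq_trans gdeg; apply: Lam_min => // k kE.
exact: (vanish_vgeH q_gt1 q_eq0 (hPon k) (gvan (Sub k kE))).
Qed.
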